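(* Let $L>0$ and let $\mathcal{A}$ be an iterative first-order method which, for every convex $L$-$\mathrm{QG}^+$ function $f$ and every starting point $x_0$, produces iterates $(x_i)_{i\in\mathbb{N}}$ such that, for some sequence $(g_i)_{i\in\mathbb{N}}$ of subgradients $g_i\in\partial f(x_i)$, for all $k$, $$\Big\langle g_k,\ x_k-\Big[\frac{k}{k+1}x_{k-1}+\frac1{k+1}x_0-\frac1{k+1}\sum_{i=0}^{k-1}\frac1L g_i\Big]\Big\rangle\le 0$$ (for $k=0$ the term $\frac{k}{k+1}x_{k-1}$ and the sum are zero, so the inequality is trivial). Then, for every convex $L$-$\mathrm{QG}^+$ function $f$, every starting point $x_0$ and every $n\in\mathbb{N}$, the output $x_n$ of $\mathcal{A}$ satisfies $$f(x_n)-f_\star\le\frac L2\,\frac1{n+1}\,d(x_0,\mathcal{X}_\star)^2 .$$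
   Context: All functions $f:\mathbb{R}^d\to\mathbb{R}$ considered are assumed to have a non-empty set of global minimizers $\mathcal{X}_\star$; $f_\star=\min_{x} f(x)$; $d(x,\mathcal{X}_\star)=\min_{x_\star\in\mathcal{X}_\star}\|x-x_\star\|_2$. The function $f$ is $L$-quadratically upper bounded ($L$-$\mathrm{QG}^+$) if $f(x)-f_\star\le\frac L2 d(x,\mathcal{X}_\star)^2$ for all $x\in\mathbb{R}^d$. $\partial f(x)=\{g:\ f(y)\ge f(x)+\langle g,y-x\rangle\ \forall y\in\mathbb{R}^d\}$ is the subdifferential. *)

(* Defs.v *)
From mathcomp Require Import all_boot all_order all_algebra.
From mathcomp Require Import all_classical all_reals all_analysis.

Set Implicit Arguments.
Unset Strict Implicit.
Unset Printing Implicit Defensive.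

Import Order.TTheory GRing.Theory Num.Theory.

Local Open Scope classical_set_scope.
Local Open Scope ring_scope.

(* The library norm on ['rV[R]_d] is the sup norm, hence an explicit Euclidean
   structure. *)
Definition dotp (R : realType) (d : nat) (u v : 'rV[R]_d) : R :=
  \sum_(i < d) u 0 i * v 0 i.

Definition norm2 (R : realType) (d : nat) (u : 'rV[R]_d) : R :=
  Num.sqrt (dotp u u).

Definition minimizers (R : realType) (d : nat) (f : 'rV[R]_d -> R) :
    set 'rV[R]_d :=
  [set x | forall y, f x <= f y].

(* A minimum as soon as [minimizers f] is nonempty. *)
Definition fmin (R : realType) (d : nat) (f : 'rV[R]_d -> R) : R :=
  inf (range f).

(* A minimum when [X] is closed and nonempty, in particular when [X] is the
   nonempty set of minimizers of a (finite, hence continuous) convex function. *)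
Definition dist_to (R : realType) (d : nat) (x : 'rV[R]_d)
    (X : set 'rV[R]_d) : R :=
  inf [set norm2 (x - y) | y in X].

Definition subdifferential (R : realType) (d : nat) (f : 'rV[R]_d -> R)
    (x : 'rV[R]_d) : set 'rV[R]_d :=
  [set g | forall y, f x + dotp g (y - x) <= f y].

Definition QGplus (R : realType) (d : nat) (L : R) (f : 'rV[R]_d -> R) : Prop :=
  forall x, f x - fmin f <= L / 2 * dist_to x (minimizers f) ^+ 2.

Definition convex_QGplus (R : realType) (d : nat) (L : R)
    (f : 'rV[R]_d -> R) : Prop :=
  [/\ convex_function setT f, minimizers f !=set0 & QGplus L f].

(* A method maps an objective and a starting point to the sequence of its
   iterates.  The dependence on the objective is unrestricted, so that both
   fixed-step methods (run with any subgradient oracle) and methods using exact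
   line searches are covered. *)
Definition method (R : realType) (d : nat) : Type :=
  ('rV[R]_d -> R) -> 'rV[R]_d -> nat -> 'rV[R]_d.

(* Main.v *)
Require Import Defs.
From mathcomp Require Import all_boot all_order all_algebra.
From mathcomp Require Import all_classical all_reals all_analysis.
From mathcomp Require Import ring lra.

Set Implicit Arguments.
Unset Strict Implicit.
Unset Printing Implicit Defensive.

Import Order.TTheory GRing.Theory Num.Theory.

Local Open Scope classical_set_scope.
Local Open Scope ring_scope.

(** Fix a minimizer [z] and put [w_k = x_0 - z - (1/L) sum_(i < k) g_i].  The
    subgradient inequality at [x_k], tested at [z + g_k / L] and combined with
    the quadratic upper bound, gives
    [f x_k - f z <= <g_k, x_k - z> - |g_k|^2 / (2 L)].  Adding [k] times the
    subgradient inequality between [x_k] and [x_(k-1)] and using the hypothesis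
    on the method, the potential [k (f x_(k-1) - f z) + (L / 2) |w_k|^2] is
    nonincreasing in [k].  Its initial value is [(L / 2) |x_0 - z|^2], and one
    takes the infimum over [z]. *)

Section Dotp.
Context {R : realType} {d : nat}.
Implicit Types (u v w : 'rV[R]_d) (a : R).

Lemma dotpC u v : dotp u v = dotp v u.
Proof. by apply: eq_bigr => i _; rewrite mulrC. Qed.

Lemma dotpDr u v w : dotp u (v + w) = dotp u v + dotp u w.
Proof. by rewrite -big_split; apply: eq_bigr => i _; rewrite mxE mulrDr. Qed.

Lemma dotpZr u a v : dotp u (a *: v) = a * dotp u v.
Proof. by rewrite mulr_sumr; apply: eq_bigr => i _; rewrite mxE mulrCA. Qed.

Lemma dotpBr u v w : dotp u (v - w) = dotp u v - dotp u w.
Proof. by rewrite -scaleN1r dotpDr dotpZr mulN1r. Qed.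

Lemma dotpBl u v w : dotp (u - v) w = dotp u w - dotp v w.
Proof. by rewrite dotpC dotpBr !(dotpC w). Qed.

Lemma dotpZl a u v : dotp (a *: u) v = a * dotp u v.
Proof. by rewrite dotpC dotpZr dotpC. Qed.

Lemma sqr_norm2 u : norm2 u ^+ 2 = dotp u u.
Proof.
by rewrite sqr_sqrtr //; apply: sumr_ge0 => i _; rewrite -expr2 sqr_ge0.
Qed.

End Dotp.

Section Distance.
Context {R : realType} {d : nat}.
Implicit Types (x z : 'rV[R]_d) (X : set 'rV[R]_d).

Lemma dist_to_ge0 x X : 0 <= dist_to x X.
Proof.
rewrite /dist_to; set D := [set norm2 (x - y) | y in X].
(* For empty [X] the infimum takes its default value [0]. *)
have [->|D0] := eqVneq D set0; first by rewrite inf0.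
by apply: lb_le_inf; [exact/set0P|move=> _ [y _ <-]; exact: sqrtr_ge0].
Qed.

Lemma dist_to_le x z X : X z -> dist_to x X <= norm2 (x - z).
Proof.
move=> Xz; apply: ge_inf; last by exists z.
by exists 0 => _ [y _ <-]; exact: sqrtr_ge0.
Qed.

(** Serves to pass from a bound for each minimizer to the distance: for [c > 0], [Num.sqrt c] is a
    lower bound of all the norms, hence of their infimum. *)
Lemma le_sqr_dist_to x X (c : R) : X !=set0 ->
  (forall z, X z -> c <= dotp (x - z) (x - z)) -> c <= dist_to x X ^+ 2.
Proof.
move=> [z0 Xz0] cX; have [c0|c0] := leP c 0; first exact: le_trans (sqr_ge0 _).
rewrite -(sqr_sqrtr (ltW c0)) ler_sqr ?nnegrE ?sqrtr_ge0 ?dist_to_ge0 //.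
apply: lb_le_inf; first by exists (norm2 (x - z0)), z0.
by move=> _ [z Xz <-]; apply: ler_wsqrtr; exact: cX.
Qed.

End Distance.

Section QGplus.
Context {R : realType} {d : nat}.
Variables (L : R) (f : 'rV[R]_d -> R) (z : 'rV[R]_d).
Hypotheses (L_gt0 : 0 < L) (fz : minimizers f z).

Lemma fmin_minimizer : fmin f = f z.
Proof.
apply/eqP; rewrite eq_le; apply/andP; split.
  by apply: ge_inf; [exists (f z) => _ [y _ <-]; exact: fz|exists z].
by apply: lb_le_inf; [exists (f z), z|move=> _ [y _ <-]; exact: fz].
Qed.

Lemma QGplus_minimizer y :
  QGplus L f -> f y - f z <= L / 2 * dotp (y - z) (y - z).
Proof.
move=> /(_ y); rewrite fmin_minimizer => /le_trans; apply.
rewrite ler_wpM2l ?divr_ge0 ?(ltW L_gt0) // -sqr_norm2.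
by rewrite ler_sqr ?nnegrE ?dist_to_ge0 ?sqrtr_ge0 // dist_to_le.
Qed.

Lemma QGplus_subgradient x g : QGplus L f -> subdifferential f x g ->
  f x - f z <= dotp g (x - z) - L^-1 / 2 * dotp g g.
Proof.
(* This point maximizes over [y] the gap [dotp g (y - z) - L / 2 * dotp (y - z) (y - z)] between the
   affine minorant and the quadratic majorant of [f]. *)
move=> qg /(_ (z + L^-1 *: g)).
have := QGplus_minimizer (z + L^-1 *: g) qg.
rewrite [z + _]addrC addrK dotpZl dotpZr !dotpBr dotpDr dotpZr.
have -> : L / 2 * (L^-1 * (L^-1 * dotp g g)) = L^-1 / 2 * dotp g g.
  by field; rewrite gt_eqF.
lra.
Qed.

Lemma potential_step (x0 x x' s g : 'rV[R]_d) (k : nat) :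
  QGplus L f -> subdifferential f x g ->
  dotp g (x - ((k%:R / k.+1%:R) *: x' + k.+1%:R^-1 *: x0 - k.+1%:R^-1 *: s))
    <= 0 ->
  k.+1%:R * (f x - f z)
    + L / 2 * dotp (x0 - z - (s + L^-1 *: g)) (x0 - z - (s + L^-1 *: g))
  <= k%:R * (f x' - f z) + L / 2 * dotp (x0 - z - s) (x0 - z - s).
Proof.
move=> qg fg; set v := (X in dotp g X); set w := x0 - z - s => gv.
(* Scaling by [k.+1] clears the denominators; the two occurrences of [z] cancel. *)
have vE : k.+1%:R *: v = (x - z) + k%:R *: (x - x') - w.
  apply/rowP => i; rewrite !mxE -natr1; field.
  by rewrite natr1 pnatr_eq0.
have {}gv : dotp g (x - z) + k%:R * dotp g (x - x') - dotp g w <= 0.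
  by rewrite -dotpZr -dotpDr -dotpBr -vE dotpZr mulr_ge0_le0.
have fx := QGplus_subgradient qg fg.
have fx' : k%:R * (f x - f x') <= k%:R * dotp g (x - x').
  by rewrite ler_wpM2l //; have := fg x'; rewrite !dotpBr; lra.
have -> : x0 - z - (s + L^-1 *: g) = w - L^-1 *: g by rewrite opprD addrA.
have -> : L / 2 * dotp (w - L^-1 *: g) (w - L^-1 *: g)
    = L / 2 * dotp w w - dotp g w + L^-1 / 2 * dotp g g.
  clearbody w; rewrite dotpBl !dotpBr !dotpZl !dotpZr (dotpC w g).
  by field; rewrite gt_eqF.
(* Split [k.+1%:R * (f x - f z)] into [f x - f z], [k%:R * (f x - f x')] and [k%:R * (f x' - f z)].
   The terms in [dotp g g] cancel, and what remains is [gv]. *)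
rewrite -natr1; lra.
Qed.

End QGplus.

Theorem theorem2p4 (R : realType) (d : nat) (L : R) (A : method R d) :
  0 < L ->
  (forall (f : 'rV[R]_d -> R) (x0 : 'rV[R]_d), convex_QGplus L f ->
    A f x0 0%N = x0 /\
    exists g : nat -> 'rV[R]_d,
      (forall i, subdifferential f (A f x0 i) (g i)) /\
      (forall k : nat,
        dotp (g k)
          (A f x0 k
           - ((k%:R / k.+1%:R) *: A f x0 k.-1
              + k.+1%:R^-1 *: x0
              - k.+1%:R^-1 *: \sum_(i < k) L^-1 *: g i)) <= 0)) ->
  forall (f : 'rV[R]_d -> R) (x0 : 'rV[R]_d) (n : nat), convex_QGplus L f ->
    f (A f x0 n) - fmin f
      <= L / 2 * n.+1%:R^-1 * dist_to x0 (minimizers f) ^+ 2.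
Proof.
move=> L_gt0 HA f x0 n fqg; have [_ [g [fg gA]]] := HA f x0 fqg.
case: fqg => _ f0 qg; set x := A f x0 in fg gA *.
have c_gt0 : 0 < L / 2 * n.+1%:R^-1 by rewrite !mulr_gt0 ?invr_gt0.
(* Isolating the squared distance leaves a left side independent of [z], to be compared with each
   [dotp (x0 - z) (x0 - z)]. *)
rewrite mulrC -ler_pdivrMr //; apply: le_sqr_dist_to => // z fz.
rewrite ler_pdivrMr // (fmin_minimizer fz).
pose w k := x0 - z - \sum_(i < k) L^-1 *: g i.
have potential k : k.+1%:R * (f (x k) - f z) + L / 2 * dotp (w k.+1) (w k.+1)
    <= L / 2 * dotp (x0 - z) (x0 - z).
  elim: k => [|k IH]; rewrite {1 2}/w big_ord_recr /=;
    apply: le_trans (potential_step L_gt0 fz qg (fg _) (gA _)) _ => //.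
  (* For [k = 0] the previous iterate reads [x 0.-1], that is [x 0], but has weight [0]. *)
  by rewrite big_ord0 subr0 mul0r add0r.
rewrite mulrA ler_pdivlMr // mulrC [leRHS]mulrC.
(* The nonnegative square of [w n.+1] is dropped from the potential. *)
apply: le_trans (potential n); rewrite lerDl -sqr_norm2.
by rewrite mulr_ge0 ?sqr_ge0 // divr_ge0 ?ltW.
Qed.
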